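(* For every positive real number $x\neq 1$, $$-\gamma<-\gamma\, H(x,1/x)<\frac{\gamma^2}{\psi\big(H(x,1/x)\big)}<\psi\Big(\frac{1}{H(x,1/x)}\Big)<H\big(\psi(x),\psi(1/x)\big),$$ and for $x=1$ all of these inequalities become equalities (so equality holds if and only if $x=1$).
   Context: $\psi=\Gamma'/\Gamma$ is the digamma function on $(0,\infty)$, $\gamma$ is Euler's constant (so $\psi(1)=-\gamma$), and $H(a,b)=\frac{2ab}{a+b}$ is the harmonic mean of real numbers $a,b$ (with $a+b\ne 0$); in particular $H(x,1/x)=\frac{2}{x+1/x}$. *)

(* Defs.v *)
From Stdlib Require Export Reals.
From Coquelicot Require Export Coquelicot.
Open Scope R_scope.

(* Euler's integral; meaningful for [0 < x]. Only positive [t] contribute,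
   where [Rpower t (x - 1)] is the genuine real power. *)
Definition Gamma (x : R) : R :=
  RInt_gen (fun t => Rpower t (x - 1) * exp (- t))
           (at_right 0) (Rbar_locally p_infty).

Definition digamma (x : R) : R := Derive Gamma x / Gamma x.

Definition euler_gamma : R :=
  real (Lim_seq (fun n => sum_n_m (fun k => / INR k) 1 n - ln (INR n))).

(* Division is total, so the value is the harmonic mean only if [a + b <> 0]. *)
Definition Hmean (a b : R) : R := 2 * a * b / (a + b).

(* Main.v *)
(* Write S(x, y) = sum_(k >= 0) 1 / ((x + k) (y + k)) and g for Euler's constant.

   The bound t^h <= x^h (1 + h (t / x - 1)), integrated against Euler's kernel, gives
   Gamma (x + h) <= x^h Gamma x for 0 <= h <= 1.  Together with the functional equation it
   squeezes ln Gamma y - ln Gamma x between (y - x) psi x and (y - x) psi y, where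
   psi x = (x - 1) S(1, x) - g; as psi is continuous, it is the digamma function.

   With Z = S(1, 1) = zeta(2) the series yields
   Z (1 - 1/x) <= psi x + g <= Z (x - 1),  psi x + psi (1/x) <= -2 g,
   and psi h + g <= 1 - 1/h for h < 1.  With h = H(x, 1/x) and t = 1/h, clearing the negative
   denominators turns the last three inequalities of the chain into h psi h < -g,
   psi t psi (1/t) < g^2 and 2 psi x psi (1/x) < psi t (psi x + psi (1/x)).  These follow
   from the bounds above and from 0 < g < 1, Z >= 3/2. *)
Require Import Defs.
From Stdlib Require Import Lra Lia.

(** * Euler's integral *)

Lemma ball_R (x y e : R) : ball x e y <-> Rabs (y - x) < e.
Proof. reflexivity. Qed.

Lemma at_right0_prod_infty (P : R * R -> Prop) (a0 b0 : R) :
  0 < a0 ->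
  (forall a b, 0 < a < a0 -> b0 < b -> P (a, b)) ->
  filter_prod (at_right 0) (Rbar_locally p_infty) P.
Proof.
intros Ha0 HP.
apply (Filter_prod _ _ _ (fun a => 0 < a < a0) (fun b => b0 < b)).
- exists (mkposreal a0 Ha0); intros y Hy Hy0.
  apply -> ball_R in Hy; apply Rabs_def2 in Hy; simpl in Hy; lra.
- now exists b0.
- intros a b Ha Hb; now apply HP.
Qed.

Lemma ex_RInt_pos (f : R -> R) (a b : R) :
  (forall t, 0 < t -> continuous f t) -> 0 < a -> 0 < b -> ex_RInt f a b.
Proof.
intros Hf Ha Hb; apply (@ex_RInt_continuous R_CompleteNormedModule).
intros t Ht; apply Hf.
revert Ht; unfold Rmin; destruct (Rle_dec a b); lra.
Qed.

(** For a nonnegative integrand the integral grows with the interval, so the supremum of the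
    integrals over all [[a, b]] is the limit. *)
Lemma ex_RInt_gen_bounded (f : R -> R) (M : R) :
  (forall t, 0 < t -> continuous f t) ->
  (forall t, 0 < t -> 0 <= f t) ->
  (forall a b, 0 < a -> a <= b -> RInt f a b <= M) ->
  ex_RInt_gen f (at_right 0) (Rbar_locally p_infty).
Proof.
intros Hc Hf HM.
set (E := fun y => exists a b, 0 < a /\ a <= b /\ y = RInt f a b).
destruct (completeness E) as [l [Hub Hlub]].
- exists M; intros y (a & b & Ha & Hab & ->); now apply HM.
- exists (RInt f 1 1), 1, 1; repeat split; lra.
- exists l; intros P [eps Heps].
  (* Some interval comes within [eps] of the supremum; every interval containing it then does so
     too. *)
  assert (Hex : exists a0 b0, 0 < a0 /\ a0 <= b0 /\ l - eps < RInt f a0 b0).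
  { destruct (Classical_Prop.classic
      (exists a0 b0, 0 < a0 /\ a0 <= b0 /\ l - eps < RInt f a0 b0)) as [H | H]; [exact H |].
    assert (l <= l - eps); [| destruct eps as [e He]; simpl in *; lra].
    apply Hlub; intros y (a & b & Ha & Hab & ->).
    apply Rnot_lt_le; intros Hlt; apply H; now exists a, b. }
  destruct Hex as (a0 & b0 & Ha0 & Hab0 & Hl).
  apply at_right0_prod_infty with a0 b0; [exact Ha0 |].
  intros a b Ha Hb; exists (RInt f a b); split; simpl.
  + apply (@RInt_correct R_CompleteNormedModule), ex_RInt_pos; try assumption; lra.
  + apply Heps.
    assert (Hle : RInt f a b <= l) by (apply Hub; exists a, b; repeat split; lra).
    assert (Hge : RInt f a0 b0 <= RInt f a b).
    { rewrite <- (RInt_Chasles f a a0 b), <- (RInt_Chasles f a0 b0 b);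
        try (apply ex_RInt_pos; try assumption; lra).
      assert (0 <= RInt f a a0).
      { apply RInt_ge_0; try lra; [apply ex_RInt_pos; try assumption; lra |].
        intros t Ht; apply Hf; lra. }
      assert (0 <= RInt f b0 b).
      { apply RInt_ge_0; try lra; [apply ex_RInt_pos; try assumption; lra |].
        intros t Ht; apply Hf; lra. }
      unfold plus; simpl; lra. }
    apply ball_R, Rabs_def1; destruct eps as [e He]; simpl in *; lra.
Qed.

(** The fundamental theorem of calculus with limits of the antiderivative at both ends; it carries
    the integration by parts in [Gamma_succ]. *)
Lemma is_RInt_gen_antiderivative (F f : R -> R) (la lb : R) :
  (forall t, 0 < t -> is_derive F t (f t)) ->
  (forall t, 0 < t -> continuous f t) ->
  filterlim F (at_right 0) (locally la) ->
  filterlim F (Rbar_locally p_infty) (locally lb) ->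
  is_RInt_gen f (at_right 0) (Rbar_locally p_infty) (lb - la).
Proof.
intros HF Hf Hla Hlb.
assert (Hlim : filterlim (fun ab : R * R => minus (F (snd ab)) (F (fst ab)))
  (filter_prod (at_right 0) (Rbar_locally p_infty)) (locally (lb - la))).
{ unfold minus.
  apply (filterlim_comp_2 (G := locally lb) (H := locally (opp la))).
  - eapply filterlim_comp; [apply filterlim_snd | exact Hlb].
  - eapply filterlim_comp; [| apply (filterlim_opp (V := R_NormedModule) la)].
    eapply filterlim_comp; [apply filterlim_fst | exact Hla].
  - apply (filterlim_plus (V := R_NormedModule) lb (opp la)). }
intros P HP; specialize (Hlim P HP); unfold filtermapi; unfold filtermap in Hlim.
(* [F] is an antiderivative on positive reals only, so both endpoints must be positive, which holds
   eventually. *)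
assert (Hpos : filter_prod (at_right 0) (Rbar_locally p_infty)
   (fun ab : R * R => 0 < fst ab /\ 0 < snd ab)).
{ apply at_right0_prod_infty with 1 0; [lra |]; intros; simpl; lra. }
generalize (filter_and _ _ Hlim Hpos); apply filter_imp.
intros [a b] [H [Ha Hb]]; simpl in *.
exists (minus (F b) (F a)); split; [| exact H].
apply (is_RInt_derive (V := R_CompleteNormedModule)); intros t Ht; [apply HF | apply Hf];
  revert Ht; unfold Rmin; destruct (Rle_dec a b); lra.
Qed.

Definition gamma_integrand (x t : R) : R := Rpower t (x - 1) * exp (- t).

Lemma gamma_integrand_pos (x t : R) : 0 < gamma_integrand x t.
Proof. apply Rmult_lt_0_compat; apply exp_pos. Qed.

Lemma is_derive_Rpower (y t : R) :
  0 < t -> is_derive (fun s => Rpower s y) t (y * Rpower t (y - 1)).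
Proof. intros Ht; apply is_derive_Reals, derivable_pt_lim_power, Ht. Qed.

Lemma continuous_gamma_integrand (x t : R) :
  0 < t -> continuous (gamma_integrand x) t.
Proof.
intros Ht; apply (@ex_derive_continuous R_AbsRing R_NormedModule).
apply (ex_derive_mult (fun t => Rpower t (x - 1)) (fun t => exp (- t))).
- eexists; now apply is_derive_Rpower.
- auto_derive; trivial.
Qed.

Lemma ln_le_sub_1 (u : R) : 0 < u -> ln u <= u - 1.
Proof. intros Hu; generalize (exp_ineq1_le (ln u)); rewrite exp_ln; lra. Qed.

Lemma Rpower_succ (t y : R) : 0 < t -> Rpower t (y + 1) = Rpower t y * t.
Proof. intros Ht; rewrite Rpower_plus, Rpower_1; trivial. Qed.

(* From [ln u <= u / c + ln c - 1] with [u = 1 + t] and [c = y]. *)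
Lemma Rpower_succ_le_exp (y t : R) :
  0 < y -> 0 < t -> Rpower (1 + t) y <= exp (1 + y * (ln y - 1)) * exp t.
Proof.
intros Hy Ht; unfold Rpower; rewrite <- exp_plus.
assert (H := ln_le_sub_1 ((1 + t) / y)).
rewrite ln_div in H by lra.
assert (H1 : y * (ln (1 + t) - ln y) <= y * ((1 + t) / y - 1)).
{ apply Rmult_le_compat_l; [lra |]; apply H, Rdiv_lt_0_compat; lra. }
replace (y * ((1 + t) / y - 1)) with (1 + t - y) in H1 by (field; lra).
destruct (Rle_lt_or_eq_dec (y * ln (1 + t)) (1 + y * (ln y - 1) + t)) as [E | E]; [lra | |].
- left; now apply exp_increasing.
- rewrite E; lra.
Qed.

(* [(t / (1 + t)) ^ x / x] has derivative [t ^ (x - 1) / (1 + t) ^ (x + 1)], which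
   dominates the integrand up to a constant. *)
Lemma gamma_integrand_le (x t : R) :
  0 < x -> 0 < t ->
  gamma_integrand x t <=
  exp (1 + (x + 1) * (ln (x + 1) - 1)) * (Rpower t (x - 1) / Rpower (1 + t) (x + 1)).
Proof.
intros Hx Ht; unfold gamma_integrand.
set (K := exp (1 + (x + 1) * (ln (x + 1) - 1))).
assert (HK := Rpower_succ_le_exp (x + 1) t ltac:(lra) Ht); fold K in HK.
assert (Hp : 0 < Rpower (1 + t) (x + 1)) by apply exp_pos.
assert (Hq : 0 < Rpower t (x - 1)) by apply exp_pos.
replace (K * (Rpower t (x - 1) / Rpower (1 + t) (x + 1)))
  with (Rpower t (x - 1) * (K / Rpower (1 + t) (x + 1))) by (field; lra).
apply Rmult_le_compat_l; [lra |].
apply Rmult_le_reg_r with (Rpower (1 + t) (x + 1)); [exact Hp |].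
replace (K / Rpower (1 + t) (x + 1) * Rpower (1 + t) (x + 1)) with K by (field; lra).
apply Rmult_le_reg_l with (exp t); [apply exp_pos |].
replace (exp t * (exp (- t) * Rpower (1 + t) (x + 1))) with (Rpower (1 + t) (x + 1)); [lra |].
rewrite <- Rmult_assoc, <- exp_plus, Rplus_opp_r, exp_0; ring.
Qed.

Lemma is_derive_beta_antiderivative (x t : R) :
  0 < x -> 0 < t ->
  is_derive (fun s => Rpower (s / (1 + s)) x / x) t
    (Rpower t (x - 1) / Rpower (1 + t) (x + 1)).
Proof.
intros Hx Ht.
assert (Hd : 0 < t / (1 + t)) by (apply Rdiv_lt_0_compat; lra).
assert (H : is_derive (fun s => Rpower (s / (1 + s)) x) t
   (scal (1 / (1 + t) ^ 2) (x * Rpower (t / (1 + t)) (x - 1)))).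
{ apply (is_derive_comp (fun u => Rpower u x) (fun s => s / (1 + s))).
  - now apply is_derive_Rpower.
  - auto_derive; [lra | field; lra]. }
apply (is_derive_scal_l _ _ _ (/ x)) in H.
replace (Rpower t (x - 1) / Rpower (1 + t) (x + 1)) with
  (scal (scal (1 / (1 + t) ^ 2) (x * Rpower (t / (1 + t)) (x - 1))) (/ x)); [exact H |].
unfold scal; simpl; unfold mult; simpl.
unfold Rdiv at 2; rewrite <- Rpower_mult_distr by (try apply Rinv_0_lt_compat; lra).
replace (Rpower (/ (1 + t)) (x - 1)) with (/ Rpower (1 + t) (x - 1)).
2:{ unfold Rpower; rewrite ln_Rinv by lra; rewrite <- exp_Ropp; f_equal; ring. }
(* Lowering the exponent [x + 1] to [x - 1] leaves factors [1 + t] and a single power of [1 + t] for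
   [field]. *)
replace (x + 1) with (x - 1 + 1 + 1) by ring.
rewrite !Rpower_succ by lra.
assert (0 < Rpower (1 + t) (x - 1)) by apply exp_pos.
field; repeat split; lra.
Qed.

Lemma continuous_beta_integrand (x t : R) :
  0 < t -> continuous (fun t => Rpower t (x - 1) / Rpower (1 + t) (x + 1)) t.
Proof.
intros Ht; apply (@ex_derive_continuous R_AbsRing R_NormedModule).
apply ex_derive_div; [| | apply Rgt_not_eq, exp_pos]; unfold Rpower; auto_derive; lra.
Qed.

(** The antiderivative of the dominating function takes values between [0] and [1 / x], so the bound
    does not depend on [a] and [b]. *)
Lemma RInt_gamma_integrand_le (x a b : R) :
  0 < x -> 0 < a -> a <= b ->
  RInt (gamma_integrand x) a b <= exp (1 + (x + 1) * (ln (x + 1) - 1)) / x.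
Proof.
intros Hx Ha Hab.
set (K := exp (1 + (x + 1) * (ln (x + 1) - 1))).
assert (HK : 0 < K) by apply exp_pos.
assert (Hi : is_RInt (fun t => Rpower t (x - 1) / Rpower (1 + t) (x + 1)) a b
   (minus (Rpower (b / (1 + b)) x / x) (Rpower (a / (1 + a)) x / x))).
{ apply (is_RInt_derive (fun s => Rpower (s / (1 + s)) x / x)); rewrite Rmin_left by lra;
    intros t Ht.
  - apply is_derive_beta_antiderivative; lra.
  - apply continuous_beta_integrand; lra. }
apply (is_RInt_scal _ _ _ K) in Hi.
apply Rle_trans with
  (scal K (minus (Rpower (b / (1 + b)) x / x) (Rpower (a / (1 + a)) x / x))).
- assert (Hi2 := is_RInt_unique _ _ _ _ Hi).
  refine (Rle_trans _ _ _ _ (Req_le _ _ Hi2)).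
  apply RInt_le; [exact Hab | | now eexists; apply Hi |].
  + apply ex_RInt_pos; [apply continuous_gamma_integrand | lra | lra].
  + intros t Ht; apply gamma_integrand_le; lra.
- unfold scal, minus, plus, opp; simpl; unfold mult; simpl; unfold Rdiv at 3.
  apply Rmult_le_compat_l; [lra |].
  assert (H1 : Rpower (b / (1 + b)) x <= 1).
  { apply Rle_trans with (Rpower 1 x);
      [| unfold Rpower; rewrite ln_1, Rmult_0_r, exp_0; lra].
    apply Rle_Rpower_l; [lra |]; split; [apply Rdiv_lt_0_compat; lra |].
    apply Rmult_le_reg_r with (1 + b); [lra |].
    replace (b / (1 + b) * (1 + b)) with b by (field; lra); lra. }
  assert (H2 : 0 < Rpower (a / (1 + a)) x / x)
    by (apply Rdiv_lt_0_compat; [apply exp_pos | lra]).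
  assert (H3 : Rpower (b / (1 + b)) x / x <= 1 / x).
  { apply Rmult_le_compat_r; [left; apply Rinv_0_lt_compat; lra | exact H1]. }
  unfold Rdiv in *; lra.
Qed.

Lemma is_RInt_gen_Gamma (x : R) :
  0 < x ->
  is_RInt_gen (gamma_integrand x) (at_right 0) (Rbar_locally p_infty) (Gamma x).
Proof.
intros Hx; apply (RInt_gen_correct (V := R_CompleteNormedModule)); try typeclasses eauto.
apply ex_RInt_gen_bounded with (exp (1 + (x + 1) * (ln (x + 1) - 1)) / x).
- apply continuous_gamma_integrand.
- intros t _; left; apply gamma_integrand_pos.
- intros a b; now apply RInt_gamma_integrand_le.
Qed.

Lemma is_RInt_gen_le (f g : R -> R) (lf lg : R) :
  (forall t, 0 < t -> 0 <= f t <= g t) ->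
  is_RInt_gen f (at_right 0) (Rbar_locally p_infty) lf ->
  is_RInt_gen g (at_right 0) (Rbar_locally p_infty) lg -> lf <= lg.
Proof.
intros Hfg Hf Hg; apply Rle_trans with (1 := Rle_abs lf).
apply (RInt_gen_norm (V := R_CompleteNormedModule) (Fa := at_right 0)
  (Fb := Rbar_locally p_infty) f g lf lg); try assumption.
- apply at_right0_prod_infty with 1 1; intros; simpl; lra.
- apply at_right0_prod_infty with 1 1; [lra |]; intros a b Ha _ t Ht; simpl in Ht.
  unfold norm; simpl; unfold abs; simpl; rewrite Rabs_pos_eq; apply Hfg; lra.
Qed.

(** The integral over [[1, 2]] is already positive, and integrals over larger intervals do not fall
    below it. *)
Lemma Gamma_pos (x : R) : 0 < x -> 0 < Gamma x.
Proof.
intros Hx.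
assert (Hc : forall t, 0 < t -> continuous (gamma_integrand x) t)
  by apply continuous_gamma_integrand.
assert (Hp : 0 < RInt (gamma_integrand x) 1 2).
{ apply RInt_gt_0; [lra | intros; apply gamma_integrand_pos |]; intros; apply Hc; lra. }
apply Rnot_le_lt; intros Hle.
(* If [Gamma x <= 0], this half-line is a neighbourhood of [Gamma x], so some interval around
   [[1, 2]] would have a smaller integral than [[1, 2]]. *)
destruct (is_RInt_gen_Gamma x Hx (fun y => y < RInt (gamma_integrand x) 1 2)) as [Q R HQ HR H].
- apply (locally_interval _ _ m_infty (RInt (gamma_integrand x) 1 2)); simpl; trivial; lra.
- assert (HQ' : at_right 0 (fun a => Q a /\ 0 < a < 1)).
  { apply filter_and; [exact HQ |].
    exists (mkposreal 1 Rlt_0_1); intros y Hy Hy0.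
    apply -> ball_R in Hy; apply Rabs_def2 in Hy; simpl in Hy; lra. }
  assert (HR' : Rbar_locally p_infty (fun b => R b /\ 2 < b))
    by (apply filter_and; [exact HR | now exists 2]).
  destruct (filter_ex _ HQ') as [a [Ha Ha1]].
  destruct (filter_ex _ HR') as [b [Hb Hb1]].
  destruct (H a b Ha Hb) as [y [Hy Hlt]]; simpl in Hy.
  apply (is_RInt_unique (V := R_CompleteNormedModule)) in Hy.
  rewrite <- (RInt_Chasles _ a 1 b), <- (RInt_Chasles _ 1 2 b) in Hy;
    try (apply ex_RInt_pos; try assumption; lra).
  assert (0 <= RInt (gamma_integrand x) a 1).
  { apply RInt_ge_0; [lra | apply ex_RInt_pos; try assumption; lra |].
    intros; left; apply gamma_integrand_pos. }
  assert (0 <= RInt (gamma_integrand x) 2 b).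
  { apply RInt_ge_0; [lra | apply ex_RInt_pos; try assumption; lra |].
    intros; left; apply gamma_integrand_pos. }
  unfold plus in Hy; simpl in Hy; lra.
Qed.

(** * Functional equation and growth of Gamma *)

Lemma gamma_boundary_0 (x : R) :
  0 < x -> filterlim (fun t => Rpower t x * exp (- t)) (at_right 0) (locally 0).
Proof.
intros Hx; apply filterlim_locally; intros [e He].
(* The radius is [e] to the power [1 / x], the point where [t ^ x] reaches [e]. *)
exists (mkposreal (exp (ln e / x)) (exp_pos _)); intros t Ht Ht0.
apply -> ball_R in Ht; apply Rabs_def2 in Ht; simpl in Ht.
assert (H1 : Rpower t x < e).
{ apply Rlt_le_trans with (Rpower (exp (ln e / x)) x).
  - apply Rlt_Rpower_l; lra.
  - unfold Rpower; rewrite ln_exp.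
    replace (x * (ln e / x)) with (ln e) by (field; lra); rewrite exp_ln; lra. }
assert (H2 : exp (- t) <= 1) by (rewrite <- exp_0; left; apply exp_increasing; lra).
assert (H3 : 0 < Rpower t x) by apply exp_pos.
assert (H4 := exp_pos (- t)).
apply ball_R, Rabs_def1; simpl; nra.
Qed.

Lemma gamma_boundary_infty (x : R) :
  0 < x ->
  filterlim (fun t => Rpower t x * exp (- t)) (Rbar_locally p_infty) (locally 0).
Proof.
intros Hx; apply filterlim_locally; intros [e He].
set (K := exp (1 + (x + 1 + 1) * (ln (x + 1 + 1) - 1))).
assert (HK : 0 < K) by apply exp_pos.
(* The domination at [x + 1] gives [t ^ x * exp (- t) <= K / (1 + t) ^ 2], which is below [e] once
   [K < e * t]. *)
exists (K / e); intros t Ht.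
assert (Ht0 : 0 < t) by (apply Rlt_trans with (2 := Ht); apply Rdiv_lt_0_compat; lra).
assert (H := gamma_integrand_le (x + 1) t ltac:(lra) Ht0); fold K in H.
unfold gamma_integrand in H; replace (x + 1 - 1) with x in H by ring.
rewrite !Rpower_succ in H by lra.
assert (Hm : Rpower t x <= Rpower (1 + t) x) by (apply Rle_Rpower_l; lra).
assert (Hp : 0 < Rpower t x * exp (- t)) by (apply Rmult_lt_0_compat; apply exp_pos).
assert (Hq : 0 < Rpower (1 + t) x) by apply exp_pos.
assert (Hlt : Rpower t x * exp (- t) < e).
{ apply Rle_lt_trans with (1 := H).
  apply Rmult_lt_reg_r with (Rpower (1 + t) x * (1 + t) * (1 + t)).
  { repeat apply Rmult_lt_0_compat; lra. }
  replace (K * (Rpower t x / (Rpower (1 + t) x * (1 + t) * (1 + t))) *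
    (Rpower (1 + t) x * (1 + t) * (1 + t))) with (K * Rpower t x) by (field; lra).
  assert (HKt : K < e * t).
  { apply Rmult_lt_reg_r with (/ e); [apply Rinv_0_lt_compat; lra |].
    replace (e * t * / e) with t by (field; lra); exact Ht. }
  apply Rle_lt_trans with (K * Rpower (1 + t) x); [apply Rmult_le_compat_l; lra |].
  replace (e * (Rpower (1 + t) x * (1 + t) * (1 + t)))
    with (e * (1 + t) * (1 + t) * Rpower (1 + t) x) by ring.
  apply Rmult_lt_compat_r; [exact Hq |]; nra. }
apply ball_R, Rabs_def1; simpl; lra.
Qed.

(** Integration by parts: [t ^ x * exp (- t)] has the difference of the two integrands as its
    derivative and vanishes at both ends. *)
Lemma Gamma_succ (x : R) : 0 < x -> Gamma (x + 1) = x * Gamma x.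
Proof.
intros Hx.
assert (H : is_RInt_gen (fun t => minus (scal x (gamma_integrand x t)) (gamma_integrand (x + 1) t))
   (at_right 0) (Rbar_locally p_infty) (0 - 0)).
{ apply is_RInt_gen_antiderivative with (fun t => Rpower t x * exp (- t)).
  - intros t Ht.
    assert (Hd : is_derive (fun t => Rpower t x * exp (- t)) t
      (plus (mult (x * Rpower t (x - 1)) (exp (- t))) (mult (Rpower t x) (- exp (- t))))).
    { apply (is_derive_mult (fun t => Rpower t x) (fun t => exp (- t)) t).
      - now apply is_derive_Rpower.
      - auto_derive; trivial; ring.
      - intros; apply Rmult_comm. }
    replace (minus _ _) with
      (plus (mult (x * Rpower t (x - 1)) (exp (- t))) (mult (Rpower t x) (- exp (- t))));
      [exact Hd |].
    unfold gamma_integrand; replace (x + 1 - 1) with x by ring.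
    unfold plus, mult, minus, opp, scal, plus; simpl; unfold mult; simpl; ring.
  - intros t Ht; apply (continuous_minus (V := R_NormedModule)).
    + apply (continuous_scal_r (V := R_NormedModule)), continuous_gamma_integrand, Ht.
    + apply continuous_gamma_integrand, Ht.
  - now apply gamma_boundary_0.
  - now apply gamma_boundary_infty. }
assert (H' := is_RInt_gen_minus _ _ _ _
  (is_RInt_gen_scal _ x _ (is_RInt_gen_Gamma x Hx)) (is_RInt_gen_Gamma (x + 1) ltac:(lra))).
apply (is_RInt_gen_unique (V := R_CompleteNormedModule)) in H.
apply (is_RInt_gen_unique (V := R_CompleteNormedModule)) in H'.
assert (E := eq_trans (eq_sym H) H'); clear H H'.
unfold minus, scal, plus, opp in E; simpl in E; unfold mult in E; simpl in E; lra.
Qed.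

Lemma Rpower_le_affine (u h : R) : 0 < u -> 0 <= h <= 1 -> Rpower u h <= 1 + h * (u - 1).
Proof.
intros Hu Hh.
set (w := 1 + h * (u - 1)).
assert (Hw : 0 < w) by (unfold w; nra).
(* The tangent line of [ln] at [w], applied at [u] and at [1] with weights [h] and [1 - h]. *)
assert (H1 := ln_le_sub_1 (u / w) ltac:(apply Rdiv_lt_0_compat; lra)).
assert (H2 := ln_le_sub_1 (1 / w) ltac:(apply Rdiv_lt_0_compat; lra)).
rewrite ln_div in H1 by lra; rewrite ln_div, ln_1 in H2 by lra.
assert (H3 : h * (u / w - 1) + (1 - h) * (1 / w - 1) = 0).
{ unfold w in *; field; lra. }
unfold Rpower; rewrite <- (exp_ln w Hw).
assert (H4 : h * ln u <= ln w) by nra.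
destruct H4 as [H4 | ->]; [left; now apply exp_increasing | lra].
Qed.

(** By the functional equation [t / x] has mean 1 for the weight [t ^ (x - 1) * exp (- t)], so the
    correction [h * (t / x - 1)] of the affine bound integrates to zero. *)
Lemma Gamma_shift_le (x h : R) :
  0 < x -> 0 <= h <= 1 -> Gamma (x + h) <= Rpower x h * Gamma x.
Proof.
intros Hx Hh.
assert (Hs := is_RInt_gen_Gamma (x + h) ltac:(lra)).
assert (H0 := is_RInt_gen_Gamma x Hx).
assert (H1 := is_RInt_gen_Gamma (x + 1) ltac:(lra)).
apply (is_RInt_gen_scal _ (Rpower x h * (1 - h))) in H0.
apply (is_RInt_gen_scal _ (Rpower x h * h / x)) in H1.
assert (H := is_RInt_gen_plus _ _ _ _ H0 H1).
apply (fun Hle => is_RInt_gen_le _ _ _ _ Hle Hs) in H.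
- rewrite Gamma_succ in H by exact Hx.
  unfold plus, scal in H; simpl in H; unfold mult in H; simpl in H.
  replace (Rpower x h * Gamma x) with
    (Rpower x h * (1 - h) * Gamma x + Rpower x h * h / x * (x * Gamma x)); [exact H |].
  field; lra.
- intros t Ht; split; [left; apply gamma_integrand_pos |].
  unfold plus, scal; simpl; unfold mult; simpl; unfold gamma_integrand.
  replace (x + 1 - 1) with (x - 1 + 1) by ring; rewrite Rpower_succ by exact Ht.
  replace (x + h - 1) with (x - 1 + h) by ring; rewrite Rpower_plus.
  assert (Htx : 0 < t / x) by (apply Rdiv_lt_0_compat; lra).
  replace (Rpower t h) with (Rpower x h * Rpower (t / x) h).
  2:{ rewrite Rpower_mult_distr by lra; f_equal; field; lra. }
  assert (Hb := Rpower_le_affine (t / x) h Htx Hh).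
  assert (Hc : 0 < Rpower t (x - 1) * exp (- t) * Rpower x h)
    by (repeat apply Rmult_lt_0_compat; apply exp_pos).
  apply (Rmult_le_compat_l _ _ _ (Rlt_le _ _ Hc)) in Hb.
  replace (Rpower x h * (1 - h) * (Rpower t (x - 1) * exp (- t)) +
    Rpower x h * h / x * (Rpower t (x - 1) * t * exp (- t)))
  with (Rpower t (x - 1) * exp (- t) * Rpower x h * (1 + h * (t / x - 1))) by (field; lra).
  lra.
Qed.

(** * The series of the digamma function *)

Lemma Series_le_ex (a b : nat -> R) :
  (forall n, a n <= b n) -> ex_series a -> ex_series b -> Series a <= Series b.
Proof.
intros Hab Ha Hb.
apply (is_lim_seq_le (sum_n a) (sum_n b) (Finite (Series a)) (Finite (Series b))).
- intros n; apply sum_n_m_le; exact Hab.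
- apply (Series_correct a Ha).
- apply (Series_correct b Hb).
Qed.

Definition inv_prod (x y : R) (k : nat) : R := / ((x + INR k) * (y + INR k)).
(* [hurwitz2 x x] is the Hurwitz zeta value at [(2, x)]; [hurwitz2 1 1] is [zeta 2]. *)
Definition hurwitz2 (x y : R) : R := Series (inv_prod x y).

(** The series telescopes: the terms up to index [n] add up to [1 - 1 / (n + 2)]. *)
Lemma is_series_inv_prod_1_2 : is_series (inv_prod 1 2) 1.
Proof.
change (is_lim_seq (sum_n (inv_prod 1 2)) 1).
apply (is_lim_seq_ext (fun n => 1 - / (INR n + 1 + 1))).
- intros n; induction n as [| n IH].
  + rewrite sum_O; unfold inv_prod; simpl; field.
  + rewrite sum_Sn, <- IH; change (@plus _) with Rplus; unfold inv_prod; rewrite !S_INR.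
    assert (H := pos_INR n); simpl; field; lra.
- replace (Finite 1) with (Rbar_minus 1 0) by (simpl; f_equal; ring).
  apply is_lim_seq_minus'; [apply is_lim_seq_const |].
  apply (is_lim_seq_ext (fun n => / INR (n + 2))).
  { intros n; rewrite plus_INR; simpl; f_equal; ring. }
  apply (is_lim_seq_incr_n (fun n => / INR n) 2 0).
  replace (Finite 0) with (Rbar_inv p_infty) by reflexivity.
  apply is_lim_seq_inv; [apply is_lim_seq_INR | discriminate].
Qed.

Lemma inv_prod_pos (x y : R) (k : nat) : 0 < x -> 0 < y -> 0 < inv_prod x y k.
Proof.
intros Hx Hy; assert (H := pos_INR k).
apply Rinv_0_lt_compat, Rmult_lt_0_compat; lra.
Qed.

(** Changing the shift costs a factor independent of [k], so every [inv_prod x y] is dominated by a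
    multiple of the telescoping [inv_prod 1 2]. *)
Lemma inv_shift_le (x c : R) (k : nat) :
  0 < x -> 0 < c -> / (x + INR k) <= (1 + c / x) * / (c + INR k).
Proof.
intros Hx Hc; assert (H := pos_INR k).
apply Rmult_le_reg_r with ((x + INR k) * (c + INR k)); [apply Rmult_lt_0_compat; lra |].
replace (/ (x + INR k) * ((x + INR k) * (c + INR k))) with (c + INR k) by (field; lra).
replace ((1 + c / x) * / (c + INR k) * ((x + INR k) * (c + INR k)))
  with (c + INR k + (x + c / x * INR k)) by (field; lra).
assert (0 <= c / x * INR k) by (apply Rmult_le_pos; [left; apply Rdiv_lt_0_compat |]; lra).
lra.
Qed.

Lemma ex_series_inv_prod (x y : R) : 0 < x -> 0 < y -> ex_series (inv_prod x y).
Proof.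
intros Hx Hy.
apply (@ex_series_le R_AbsRing R_CompleteNormedModule)
  with (fun k => (1 + 1 / x) * (1 + 2 / y) * inv_prod 1 2 k).
- intros k; unfold norm; simpl; unfold abs; simpl.
  rewrite Rabs_pos_eq by (left; now apply inv_prod_pos).
  unfold inv_prod; rewrite !Rinv_mult.
  replace ((1 + 1 / x) * (1 + 2 / y) * (/ (1 + INR k) * / (2 + INR k)))
    with (((1 + 1 / x) * / (1 + INR k)) * ((1 + 2 / y) * / (2 + INR k))) by ring.
  assert (H := pos_INR k).
  apply Rmult_le_compat; try (left; apply Rinv_0_lt_compat; lra); apply inv_shift_le; lra.
- apply (ex_series_scal_l (V := R_NormedModule)); eexists; exact is_series_inv_prod_1_2.
Qed.

Lemma hurwitz2_ge_first (x y : R) : 0 < x -> 0 < y -> / (x * y) <= hurwitz2 x y.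
Proof.
intros Hx Hy; unfold hurwitz2; rewrite Series_incr_1 by now apply ex_series_inv_prod.
unfold inv_prod at 1; simpl; rewrite !Rplus_0_r.
enough (0 <= Series (fun k => inv_prod x y (S k))) by lra.
assert (H := Series_le (fun k => 0 * inv_prod x y (S k)) (fun k => inv_prod x y (S k))).
rewrite Series_scal_l, Rmult_0_l in H; apply H.
- intros k; rewrite Rmult_0_l; split; [lra | left; now apply inv_prod_pos].
- now apply (ex_series_incr_1 (V := R_NormedModule) (inv_prod x y)), ex_series_inv_prod.
Qed.

Lemma hurwitz2_pos (x y : R) : 0 < x -> 0 < y -> 0 < hurwitz2 x y.
Proof.
intros Hx Hy; apply Rlt_le_trans with (2 := hurwitz2_ge_first x y Hx Hy).
now apply Rinv_0_lt_compat, Rmult_lt_0_compat.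
Qed.

Lemma hurwitz2_antitone (x x' y y' : R) :
  0 < x <= x' -> 0 < y <= y' -> hurwitz2 x' y' <= hurwitz2 x y.
Proof.
intros Hx Hy; apply Series_le_ex; try (apply ex_series_inv_prod; lra).
intros k; assert (H := pos_INR k); apply Rinv_le_contravar.
- apply Rmult_lt_0_compat; lra.
- apply Rmult_le_compat; lra.
Qed.

Lemma hurwitz2_unfold (x y : R) :
  0 < x -> 0 < y -> hurwitz2 x y = / (x * y) + hurwitz2 (x + 1) (y + 1).
Proof.
intros Hx Hy; unfold hurwitz2 at 1; rewrite Series_incr_1 by now apply ex_series_inv_prod.
f_equal.
- unfold inv_prod; simpl; f_equal; ring.
- apply Series_ext; intros k; unfold inv_prod; rewrite S_INR; f_equal; ring.
Qed.

Lemma hurwitz2_1_2 : hurwitz2 1 2 = 1.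
Proof. apply is_series_unique, is_series_inv_prod_1_2. Qed.

(** In the notation S: S(1, 1) = 1 + S(2, 2) >= 1 + S(2, 3), and S(2, 3) = S(1, 2) - 1/2 = 1/2. *)
Lemma hurwitz2_1_1_ge : 3 / 2 <= hurwitz2 1 1.
Proof.
rewrite hurwitz2_unfold by lra; assert (H := hurwitz2_unfold 1 2 ltac:(lra) ltac:(lra)).
rewrite hurwitz2_1_2 in H.
assert (H' := hurwitz2_antitone (1 + 1) (1 + 1) (1 + 1) (2 + 1) ltac:(lra) ltac:(lra)).
lra.
Qed.

(** Termwise, because [x / (x + k) = 1 - k / (x + k)] increases with [x]. *)
Lemma mul_hurwitz2_monotone (x y : R) : 0 < x <= y -> x * hurwitz2 1 x <= y * hurwitz2 1 y.
Proof.
intros Hxy; unfold hurwitz2; rewrite <- !Series_scal_l.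
apply Series_le_ex; try (apply (ex_series_scal_l (V := R_NormedModule)), ex_series_inv_prod; lra).
intros k; assert (H := pos_INR k); unfold inv_prod.
enough (0 <= y * / ((1 + INR k) * (y + INR k)) - x * / ((1 + INR k) * (x + INR k))) by lra.
replace (y * / ((1 + INR k) * (y + INR k)) - x * / ((1 + INR k) * (x + INR k)))
  with ((y - x) * INR k / ((1 + INR k) * (y + INR k) * (x + INR k))) by (field; lra).
apply Rmult_le_pos; [apply Rmult_le_pos; lra |].
left; apply Rinv_0_lt_compat; repeat apply Rmult_lt_0_compat; lra.
Qed.

(* The left-hand side is [(x - 1) * sum_(k >= 0) (k - 1) / ((k + 1) (x + k) (1 + k x))]; the
   terms with [k >= 1] are dominated by [1 / (x k (k + 1))], whose sum cancels the term [k = 0]. *)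
Lemma hurwitz2_reciprocal_le (x : R) :
  1 < x -> hurwitz2 1 x - hurwitz2 1 (1 / x) / x <= 0.
Proof.
intros Hx.
assert (Hi : 0 < 1 / x) by (apply Rdiv_lt_0_compat; lra).
rewrite (hurwitz2_unfold 1 x), (hurwitz2_unfold 1 (1 / x)) by lra.
(* The terms [k = 0] differ by [1 / x - 1]; writing [1] as the series [hurwitz2 1 2] makes the
   comparison termwise. *)
enough (H : hurwitz2 (1 + 1) (x + 1) <=
  (1 - / x) * hurwitz2 1 2 + / x * hurwitz2 (1 + 1) (1 / x + 1)).
{ rewrite hurwitz2_1_2 in H.
  replace (/ (1 * x) + hurwitz2 (1 + 1) (x + 1)
      - (/ (1 * (1 / x)) + hurwitz2 (1 + 1) (1 / x + 1)) / x)
    with (hurwitz2 (1 + 1) (x + 1) - (1 - / x + / x * hurwitz2 (1 + 1) (1 / x + 1)))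
    by (field; lra).
  lra. }
unfold hurwitz2; rewrite <- !Series_scal_l, <- Series_plus
  by (apply (ex_series_scal_l (V := R_NormedModule)), ex_series_inv_prod; lra).
apply Series_le_ex.
- intros k; assert (H := pos_INR k); unfold inv_prod.
  set (n := INR k) in *.
  enough (0 <= (1 - / x) * / ((1 + n) * (2 + n)) + / x * / ((1 + 1 + n) * (1 / x + 1 + n))
    - / ((1 + 1 + n) * (x + 1 + n))) by lra.
  assert (0 <= n * x) by (apply Rmult_le_pos; lra).
  replace ((1 - / x) * / ((1 + n) * (2 + n)) + / x * / ((1 + 1 + n) * (1 / x + 1 + n))
    - / ((1 + 1 + n) * (x + 1 + n)))
  with ((x - 1) * ((x + 1 + n) * (1 + x + n * x) - n * (1 + n) * x)
    / (x * (1 + n) * (2 + n) * (x + 1 + n) * (1 + x + n * x))) by (field; lra).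
  apply Rmult_le_pos.
  (* Expanding the product yields [n * (1 + n) * x] plus positive terms, so the subtraction
     cancels. *)
  + apply Rmult_le_pos; [lra |]; nra.
  + left; apply Rinv_0_lt_compat; repeat apply Rmult_lt_0_compat; lra.
- apply ex_series_inv_prod; lra.
- apply (ex_series_plus (V := R_NormedModule));
    apply (ex_series_scal_l (V := R_NormedModule)), ex_series_inv_prod; lra.
Qed.

(** * Euler's constant *)

Definition harmonic_gap (n : nat) : R := sum_n_m (fun k => / INR k) 1 n - ln (INR n).

(** Both sides are [ln u <= u - 1], at [u = y / (y + h)] and at [u = (y + h) / y]. *)
Lemma ln_add_sub_bounds (y h : R) :
  0 < y -> 0 <= h -> h / (y + h) <= ln (y + h) - ln y <= h / y.
Proof.
intros Hy Hh; split.
- assert (H := ln_le_sub_1 (y / (y + h)) ltac:(apply Rdiv_lt_0_compat; lra)).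
  rewrite ln_div in H by lra.
  replace (y / (y + h) - 1) with (- (h / (y + h))) in H by (field; lra); lra.
- assert (H := ln_le_sub_1 ((y + h) / y) ltac:(apply Rdiv_lt_0_compat; lra)).
  rewrite ln_div in H by lra.
  replace ((y + h) / y - 1) with (h / y) in H by (field; lra); lra.
Qed.

Lemma harmonic_gap_succ (n : nat) :
  harmonic_gap (S (S n)) =
  harmonic_gap (S n) + / (INR (S n) + 1) - (ln (INR (S n) + 1) - ln (INR (S n))).
Proof.
unfold harmonic_gap; rewrite sum_n_Sm by lia; change (@plus _) with Rplus.
rewrite (S_INR (S n)); ring.
Qed.

Lemma harmonic_gap_decr (n : nat) : harmonic_gap (S (S n)) <= harmonic_gap (S n).
Proof.
rewrite harmonic_gap_succ.
assert (H := ln_add_sub_bounds (INR (S n)) 1 (lt_0_INR _ (Nat.lt_0_succ n)) ltac:(lra)).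
unfold Rdiv in H; lra.
Qed.

(** With [m = S n] the right-hand side is the [m]-th harmonic number minus [ln (m + 1)], which
    increases with [m] from the value [1 - ln 2] at [m = 1]. *)
Lemma harmonic_gap_ge (n : nat) :
  1 - ln 2 <= harmonic_gap (S n) - (ln (INR (S n) + 1) - ln (INR (S n))).
Proof.
induction n as [| n IH].
- unfold harmonic_gap; rewrite sum_n_n; simpl; rewrite ln_1; replace (1 + 1) with 2 by ring.
  lra.
- rewrite harmonic_gap_succ, (S_INR (S n)).
  assert (Hn := lt_0_INR _ (Nat.lt_0_succ n)).
  assert (H := ln_add_sub_bounds (INR (S n) + 1) 1 ltac:(lra) ltac:(lra)).
  unfold Rdiv in H; lra.
Qed.

Lemma ln_2_lt_1 : ln 2 < 1.
Proof.
rewrite <- (ln_exp 1); apply ln_increasing; [lra |].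
assert (H := exp_ineq1 1 ltac:(lra)); lra.
Qed.

Lemma harmonic_gap_lower (n : nat) : 1 - ln 2 <= harmonic_gap (S n).
Proof.
assert (H := harmonic_gap_ge n).
assert (Hn := lt_0_INR _ (Nat.lt_0_succ n)).
assert (Hl := ln_le (INR (S n)) (INR (S n) + 1) Hn ltac:(lra)); lra.
Qed.

Lemma is_lim_seq_harmonic_gap : is_lim_seq (fun n => harmonic_gap (S n)) euler_gamma.
Proof.
destruct (ex_finite_lim_seq_decr (fun n => harmonic_gap (S n)) (1 - ln 2)) as [l Hl].
- exact harmonic_gap_decr.
- exact harmonic_gap_lower.
- replace euler_gamma with l; [exact Hl |].
  apply (is_lim_seq_incr_1 harmonic_gap) in Hl.
  apply is_lim_seq_unique in Hl; unfold euler_gamma, harmonic_gap in *; now rewrite Hl.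
Qed.

Lemma euler_gamma_pos : 0 < euler_gamma.
Proof.
assert (H := is_lim_seq_le _ _ (1 - ln 2) euler_gamma harmonic_gap_lower
  (is_lim_seq_const _) is_lim_seq_harmonic_gap).
simpl in H; generalize ln_2_lt_1; lra.
Qed.

Lemma euler_gamma_lt_1 : euler_gamma < 1.
Proof.
(* Index 1 stands for [harmonic_gap 2 = 3 / 2 - ln 2], which is below 1 since [ln 2 > 1 / 2]. *)
assert (H := is_lim_seq_decr_compare _ _ is_lim_seq_harmonic_gap harmonic_gap_decr 1%nat).
simpl in H; rewrite harmonic_gap_succ in H; unfold harmonic_gap in H.
rewrite sum_n_n in H; simpl in H; rewrite ln_1 in H.
replace (1 + 1) with 2 in H by ring; generalize ln_lt_2; lra.
Qed.

(** The classical series of [1 / (1 + k) - 1 / (x + k)] minus Euler's constant, with the factor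
    [x - 1] taken out of each difference. *)
Definition psi (x : R) : R := (x - 1) * hurwitz2 1 x - euler_gamma.

(** Termwise difference of reciprocals; it yields both the strict monotonicity of [psi] and its
    local Lipschitz bound. *)
Lemma psi_sub (x y : R) : 0 < x -> 0 < y -> psi y - psi x = (y - x) * hurwitz2 x y.
Proof.
intros Hx Hy; unfold psi, hurwitz2; ring_simplify.
enough ((y - 1) * Series (inv_prod 1 y) - (x - 1) * Series (inv_prod 1 x)
  = (y - x) * Series (inv_prod x y)) by lra.
rewrite <- !Series_scal_l, <- Series_minus
  by (apply (ex_series_scal_l (V := R_NormedModule)), ex_series_inv_prod; lra).
apply Series_ext; intros k; unfold inv_prod; assert (H := pos_INR k); field; lra.
Qed.

Lemma is_lim_seq_psi (x : R) :
  0 < x ->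
  is_lim_seq (fun n => ln (INR (S n)) - sum_n (fun k => / (x + INR k)) n) (psi x).
Proof.
intros Hx.
apply (is_lim_seq_ext
  (fun n => sum_n (fun k => (x - 1) * inv_prod 1 x k) n - harmonic_gap (S n))).
- intros n; unfold harmonic_gap.
  enough (H : sum_n (fun k => (x - 1) * inv_prod 1 x k) n + sum_n (fun k => / (x + INR k)) n
    = sum_n_m (fun k => / INR k) 1 (S n)) by lra.
  induction n as [| n IH].
  + rewrite !sum_O, sum_n_n; unfold inv_prod; simpl; field; lra.
  + rewrite sum_n_Sm by lia; rewrite <- IH, !sum_Sn; change (@plus _) with Rplus.
    unfold inv_prod; rewrite (S_INR (S n)), (S_INR n).
    assert (H := pos_INR n); simpl; field; lra.
- apply is_lim_seq_minus'; [| exact is_lim_seq_harmonic_gap].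
  apply (is_series_scal_l (V := R_NormedModule) (x - 1)).
  apply Series_correct; apply ex_series_inv_prod; lra.
Qed.

(** * Identification of [psi] with the logarithmic derivative of Gamma *)

Lemma ln_Gamma_shift (x : R) (n : nat) :
  0 < x ->
  ln (Gamma (x + INR (S n))) = ln (Gamma x) + sum_n (fun k => ln (x + INR k)) n.
Proof.
intros Hx; induction n as [| n IH].
- rewrite sum_O; simpl; rewrite Gamma_succ, ln_mult, Rplus_0_r by (try apply Gamma_pos; lra).
  ring.
- assert (H := pos_INR (S n)).
  rewrite (S_INR (S n)), <- Rplus_assoc, Gamma_succ, ln_mult, IH, sum_Sn
    by (try apply Gamma_pos; lra).
  change (@plus _) with Rplus; ring.
Qed.

(** [Gamma_shift_le] from [x] to [y] gives the upper bound; from [y] to [x + 1], where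
    [Gamma (x + 1) = x * Gamma x], it gives the lower one. *)
Lemma ln_Gamma_sub_bounds (x y : R) :
  0 < x -> x <= y <= x + 1 ->
  (y - x) * ln x - (y - x) / x <= ln (Gamma y) - ln (Gamma x) <= (y - x) * ln x.
Proof.
intros Hx Hy.
assert (Gx := Gamma_pos x Hx); assert (Gy := Gamma_pos y ltac:(lra)).
assert (H1 := Gamma_shift_le x (y - x) Hx ltac:(lra)).
assert (H2 := Gamma_shift_le y (1 - (y - x)) ltac:(lra) ltac:(lra)).
replace (x + (y - x)) with y in H1 by ring.
replace (y + (1 - (y - x))) with (x + 1) in H2 by ring.
rewrite Gamma_succ in H2 by exact Hx.
apply ln_le in H1; [| exact Gy].
apply ln_le in H2; [| now apply Rmult_lt_0_compat].
rewrite ln_mult, ln_Rpower in H1 by (try apply exp_pos; lra).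
rewrite !ln_mult, ln_Rpower in H2 by (try apply exp_pos; lra).
assert (H3 := ln_add_sub_bounds x (y - x) Hx ltac:(lra)).
replace (x + (y - x)) with y in H3 by ring.
assert (H4 := ln_le x y Hx ltac:(lra)).
split; nra.
Qed.

Lemma sum_n_ln_bounds (x y : R) (n : nat) :
  0 < x <= y ->
  (y - x) * sum_n (fun k => / (y + INR k)) n
    <= sum_n (fun k => ln (y + INR k)) n - sum_n (fun k => ln (x + INR k)) n
    <= (y - x) * sum_n (fun k => / (x + INR k)) n.
Proof.
intros Hxy; induction n as [| n IH].
- rewrite !sum_O; simpl; rewrite !Rplus_0_r.
  assert (H := ln_add_sub_bounds x (y - x) ltac:(lra) ltac:(lra)).
  replace (x + (y - x)) with y in H by ring; exact H.
- rewrite !sum_Sn; change (@plus _) with Rplus.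
  assert (Hn := pos_INR (S n)).
  assert (H := ln_add_sub_bounds (x + INR (S n)) (y - x) ltac:(lra) ltac:(lra)).
  replace (x + INR (S n) + (y - x)) with (y + INR (S n)) in H by ring; unfold Rdiv in H; lra.
Qed.

Lemma is_lim_seq_div_INR (c d : R) : 0 <= d -> is_lim_seq (fun n => c / (INR (S n) + d)) 0.
Proof.
intros Hd.
apply (is_lim_seq_div (fun _ => c) (fun n => INR (S n) + d) c p_infty);
  [apply is_lim_seq_const | | discriminate | ].
- apply is_lim_seq_le_p_loc with (fun n => INR (S n)); [exists 0%nat; intros; lra |].
  apply -> (is_lim_seq_incr_1 INR p_infty); exact is_lim_seq_INR.
- unfold is_Rbar_div, is_Rbar_mult; simpl; do 2 f_equal; ring.
Qed.

(* Passing from [x, y] to [x + n, y + n] with the functional equation, where [ln Gamma]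
   grows like [(y - x) * ln n], leaves a sum whose normalisation converges to [psi]. *)
Lemma ln_Gamma_psi_bounds (x y : R) :
  0 < x -> x <= y <= x + 1 ->
  (y - x) * psi x <= ln (Gamma y) - ln (Gamma x) <= (y - x) * psi y.
Proof.
intros Hx Hy.
set (l := ln (Gamma y) - ln (Gamma x)).
(* One error term comes from [ln_Gamma_sub_bounds] at [x + n], the other bounds [ln (x + n) - ln n];
   the [+ 0] fits [is_lim_seq_div_INR]. *)
assert (Hl : forall n,
  (y - x) * (ln (INR (S n)) - sum_n (fun k => / (x + INR k)) n) - (y - x) / (INR (S n) + x) <= l
  <= (y - x) * (ln (INR (S n)) - sum_n (fun k => / (y + INR k)) n + x / (INR (S n) + 0))).
{ intros n.
  assert (Hn := lt_0_INR _ (Nat.lt_0_succ n)).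
  assert (H1 := ln_Gamma_sub_bounds (x + INR (S n)) (y + INR (S n)) ltac:(lra) ltac:(lra)).
  assert (H2 := sum_n_ln_bounds x y n ltac:(lra)).
  rewrite !ln_Gamma_shift in H1 by lra.
  replace (y + INR (S n) - (x + INR (S n))) with (y - x) in H1 by ring.
  assert (H3 := ln_add_sub_bounds (INR (S n)) x Hn ltac:(lra)).
  rewrite (Rplus_comm (INR (S n)) x) in *; rewrite Rplus_0_r.
  assert (H4 := ln_le (INR (S n)) (x + INR (S n)) Hn ltac:(lra)).
  unfold l; split; nra. }
split.
- apply (is_lim_seq_le _ _ (Finite ((y - x) * psi x)) (Finite l)
    (fun n => proj1 (Hl n))); [| apply is_lim_seq_const].
  replace ((y - x) * psi x) with ((y - x) * psi x - 0) by ring.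
  apply is_lim_seq_minus'; [| apply is_lim_seq_div_INR; lra].
  apply (is_lim_seq_scal_l _ (y - x) (Finite (psi x))), is_lim_seq_psi, Hx.
- apply (is_lim_seq_le _ _ (Finite l) (Finite ((y - x) * psi y))
    (fun n => proj2 (Hl n))); [apply is_lim_seq_const |].
  replace (psi y) with (psi y + 0) by ring.
  apply (is_lim_seq_scal_l _ (y - x) (Finite (psi y + 0))).
  apply is_lim_seq_plus'; [apply is_lim_seq_psi; lra | apply is_lim_seq_div_INR; lra].
Qed.

(** The difference quotient lies between [psi x] and [psi (x + h)], which are at most a constant
    times [Rabs h] apart. *)
Lemma is_derive_ln_Gamma (x : R) : 0 < x -> is_derive (fun y => ln (Gamma y)) x (psi x).
Proof.
intros Hx; apply is_derive_Reals; intros eps Heps.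
set (C := hurwitz2 (x / 2) (x / 2)).
assert (HC : 0 < C) by (apply hurwitz2_pos; lra).
(* The bound [x / 2] makes [C] a Lipschitz constant, [1] admits [ln_Gamma_psi_bounds], and [eps / C]
   controls the error. *)
assert (Hd : 0 < Rmin (Rmin (x / 2) 1) (eps / C)).
{ repeat apply Rmin_glb_lt; try lra; now apply Rdiv_lt_0_compat. }
exists (mkposreal _ Hd); intros h Hh0 Hh; simpl in Hh.
assert (Hh1 : Rabs h < x / 2)
  by (eapply Rlt_le_trans; [exact Hh |]; eapply Rle_trans; apply Rmin_l).
assert (Hh2 : Rabs h < 1)
  by (eapply Rlt_le_trans; [exact Hh |]; eapply Rle_trans; [apply Rmin_l | apply Rmin_r]).
assert (Hh3 : Rabs h < eps / C) by (eapply Rlt_le_trans; [exact Hh | apply Rmin_r]).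
apply Rabs_def2 in Hh1; apply Rabs_def2 in Hh2.
assert (HQ : 0 < hurwitz2 x (x + h) <= C)
  by (split; [apply hurwitz2_pos | apply hurwitz2_antitone]; lra).
assert (Hpsi := psi_sub x (x + h) Hx ltac:(lra)).
replace (x + h - x) with h in Hpsi by ring.
assert (Hlt : Rabs h * C < eps).
{ apply Rmult_lt_reg_r with (/ C); [now apply Rinv_0_lt_compat |].
  replace (Rabs h * C * / C) with (Rabs h) by (field; lra); exact Hh3. }
assert (Hb : Rabs ((ln (Gamma (x + h)) - ln (Gamma x)) / h - psi x) <= Rabs h * C).
{ set (q := (ln (Gamma (x + h)) - ln (Gamma x)) / h).
  assert (Hq : ln (Gamma (x + h)) - ln (Gamma x) = h * q) by (unfold q; field; exact Hh0).
  destruct (Rlt_or_le 0 h) as [Hp | Hn].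
  - assert (H := ln_Gamma_psi_bounds x (x + h) Hx ltac:(lra)).
    rewrite Hq in H; replace (x + h - x) with h in H by ring.
    rewrite (Rabs_pos_eq h) by lra.
    assert (psi x <= q) by (apply Rmult_le_reg_l with h; lra).
    assert (q <= psi (x + h)) by (apply Rmult_le_reg_l with h; lra).
    rewrite Rabs_pos_eq by lra; nra.
  - assert (H := ln_Gamma_psi_bounds (x + h) x ltac:(lra) ltac:(lra)).
    replace (x - (x + h)) with (- h) in H by ring.
    rewrite (Rabs_left1 h) by lra.
    assert (q <= psi x) by (apply Rmult_le_reg_l with (- h); lra).
    assert (psi (x + h) <= q) by (apply Rmult_le_reg_l with (- h); lra).
    rewrite Rabs_left1 by lra; nra. }
lra.
Qed.

Lemma digamma_eq_psi (x : R) : 0 < x -> digamma x = psi x.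
Proof.
intros Hx; unfold digamma.
assert (HG := Gamma_pos x Hx).
assert (H : is_derive Gamma x (psi x * Gamma x)).
{ apply (is_derive_ext_loc (fun y => exp (ln (Gamma y)))).
  - exists (mkposreal x Hx); intros y Hy.
    apply -> ball_R in Hy; apply Rabs_def2 in Hy; simpl in Hy; apply exp_ln, Gamma_pos; lra.
  - rewrite <- (exp_ln (Gamma x) HG).
    apply (is_derive_comp exp (fun y => ln (Gamma y))).
    + apply is_derive_Reals, derivable_pt_lim_exp.
    + now apply is_derive_ln_Gamma. }
apply is_derive_unique in H; rewrite H; field; lra.
Qed.

(** * Harmonic mean inequalities *)

Lemma reciprocal_lt_1 (x : R) : 1 < x -> 0 < 1 / x < 1.
Proof.
intros Hx; split; [apply Rdiv_lt_0_compat; lra |].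
apply Rmult_lt_reg_r with x; [lra |]; replace (1 / x * x) with 1 by (field; lra); lra.
Qed.

Lemma add_reciprocal_gt_2 (x : R) : 1 < x -> 2 < x + 1 / x.
Proof.
intros Hx; enough (0 < x + 1 / x - 2) by lra.
replace (x + 1 / x - 2) with ((x - 1) * (x - 1) / x) by (field; lra).
apply Rdiv_lt_0_compat; [apply Rmult_lt_0_compat |]; lra.
Qed.

Lemma psi_1 : psi 1 = - euler_gamma.
Proof. unfold psi; ring. Qed.

Lemma psi_lt (x y : R) : 0 < x < y -> psi x < psi y.
Proof.
intros Hxy; assert (H := psi_sub x y ltac:(lra) ltac:(lra)).
assert (0 < (y - x) * hurwitz2 x y) by (apply Rmult_lt_0_compat; [| apply hurwitz2_pos]; lra); lra.
Qed.

(** The chord slope [hurwitz2 1 x] from the point 1 decreases in [x], so [psi] stays below its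
    tangent at 1. *)
Lemma psi_le_tangent (x : R) : 0 < x -> psi x <= - euler_gamma + hurwitz2 1 1 * (x - 1).
Proof.
intros Hx; unfold psi; destruct (Rle_or_lt 1 x) as [H | H].
- assert (HQ := hurwitz2_antitone 1 1 1 x ltac:(lra) ltac:(lra)); nra.
- assert (HQ := hurwitz2_antitone 1 1 x 1 ltac:(lra) ltac:(lra)); nra.
Qed.

(** In the variable [1 / x] the chord slope has absolute value [x * hurwitz2 1 x], which increases
    with [x]; this puts [psi] above the tangent at 1 in that variable. *)
Lemma psi_ge_reciprocal_tangent (x : R) :
  0 < x -> - euler_gamma + hurwitz2 1 1 * (1 - 1 / x) <= psi x.
Proof.
intros Hx; unfold psi.
enough (0 <= (x - 1) * (x * hurwitz2 1 x - hurwitz2 1 1) / x).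
{ replace ((x - 1) * (x * hurwitz2 1 x - hurwitz2 1 1) / x)
    with ((x - 1) * hurwitz2 1 x - hurwitz2 1 1 * (1 - 1 / x)) in H by (field; lra); lra. }
apply Rmult_le_pos; [| left; now apply Rinv_0_lt_compat].
destruct (Rle_or_lt 1 x) as [H | H].
- assert (HQ := mul_hurwitz2_monotone 1 x ltac:(lra)); nra.
- assert (HQ := mul_hurwitz2_monotone x 1 ltac:(lra)); nra.
Qed.

Lemma psi_add_reciprocal_le (x : R) : 1 < x -> psi x + psi (1 / x) <= - 2 * euler_gamma.
Proof.
intros Hx; unfold psi; assert (H := hurwitz2_reciprocal_le x Hx).
replace ((x - 1) * hurwitz2 1 x - euler_gamma + ((1 / x - 1) * hurwitz2 1 (1 / x) - euler_gamma))
  with ((x - 1) * (hurwitz2 1 x - hurwitz2 1 (1 / x) / x) - 2 * euler_gamma) by (field; lra).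
nra.
Qed.

(** Both factors are negative and bounded below by reciprocal tangents. In the product, [1 - 1 / x]
    and [1 - x] have the same sum and product, [- (x + 1 / x - 2)]. *)
Lemma psi_mul_reciprocal_le (x : R) :
  1 < x -> psi x < 0 ->
  psi x * psi (1 / x)
    <= euler_gamma ^ 2 - hurwitz2 1 1 * (hurwitz2 1 1 - euler_gamma) * (x + 1 / x - 2).
Proof.
intros Hx Hneg.
assert (Hi := reciprocal_lt_1 x ltac:(lra)).
assert (H1 := psi_ge_reciprocal_tangent x ltac:(lra)).
assert (H2 := psi_ge_reciprocal_tangent (1 / x) ltac:(lra)).
replace (1 / (1 / x)) with x in H2 by (field; lra).
assert (H3 := psi_lt (1 / x) 1 ltac:(lra)); rewrite psi_1 in H3.
assert (Hg := euler_gamma_pos).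
replace (psi x * psi (1 / x)) with ((- psi x) * (- psi (1 / x))) by ring.
replace (euler_gamma ^ 2 - hurwitz2 1 1 * (hurwitz2 1 1 - euler_gamma) * (x + 1 / x - 2))
  with ((euler_gamma - hurwitz2 1 1 * (1 - 1 / x)) * (euler_gamma - hurwitz2 1 1 * (1 - x)))
  by (field; lra).
apply Rmult_le_compat; lra.
Qed.

(** Keeping only the first term of the series gives [psi h <= 1 - 1 / h - euler_gamma]; the claim is
    then [(1 - h) * (1 - euler_gamma) > 0]. *)
Lemma mul_psi_lt (h : R) : 0 < h < 1 -> h * psi h < - euler_gamma.
Proof.
intros Hh; assert (HQ := hurwitz2_ge_first 1 h ltac:(lra) ltac:(lra)).
assert (Hg := euler_gamma_lt_1); unfold psi.
assert (H1 : 1 <= h * hurwitz2 1 h).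
{ apply Rmult_le_reg_l with (/ h); [apply Rinv_0_lt_compat; lra |].
  rewrite <- Rmult_assoc, Rinv_l, Rmult_1_l, Rmult_1_r by lra.
  now rewrite Rmult_1_l in HQ. }
nra.
Qed.

Lemma psi_mul_reciprocal_lt (t : R) : 1 < t -> psi t * psi (1 / t) < euler_gamma ^ 2.
Proof.
intros Ht.
assert (Hi := reciprocal_lt_1 t ltac:(lra)).
assert (Hg := euler_gamma_pos); assert (Hg1 := euler_gamma_lt_1); assert (HZ := hurwitz2_1_1_ge).
destruct (Rle_or_lt 0 (psi t)) as [H | H].
- assert (H3 := psi_lt (1 / t) 1 ltac:(lra)); rewrite psi_1 in H3; nra.
- apply Rle_lt_trans with (1 := psi_mul_reciprocal_le t Ht H).
  assert (0 < hurwitz2 1 1 * (hurwitz2 1 1 - euler_gamma) * (t + 1 / t - 2)); [| lra].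
  assert (H' := add_reciprocal_gt_2 t Ht).
  repeat apply Rmult_lt_0_compat; lra.
Qed.

(* With [t = (x + 1/x) / 2] and [psi x < 0], the product bound loses
   [2 * hurwitz2 1 1 * (hurwitz2 1 1 - euler_gamma) * (t - 1)] while [psi t] loses at most
   [hurwitz2 1 1 * (t - 1)]; these compare because [3 * euler_gamma < 2 * hurwitz2 1 1]. *)
Lemma psi_mean_lt (x t : R) :
  1 < x -> 2 * t = x + 1 / x ->
  psi t * (psi x + psi (1 / x)) > 2 * psi x * psi (1 / x).
Proof.
intros Hx Et.
assert (Hi := reciprocal_lt_1 x ltac:(lra)).
assert (Ht : 1 < t < x) by (assert (H := add_reciprocal_gt_2 x Hx); lra).
assert (Hg := euler_gamma_pos); assert (Hg1 := euler_gamma_lt_1); assert (HZ := hurwitz2_1_1_ge).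
assert (Hs := psi_add_reciprocal_le x Hx).
assert (Htx := psi_lt t x ltac:(lra)).
assert (H1t := psi_lt 1 t ltac:(lra)); rewrite psi_1 in H1t.
assert (Hi1 := psi_lt (1 / x) 1 ltac:(lra)); rewrite psi_1 in Hi1.
assert (Htan := psi_le_tangent t ltac:(lra)).
assert (Hprod := psi_mul_reciprocal_le x Hx).
replace (x + 1 / x - 2) with (2 * (t - 1)) in Hprod by lra.
set (a := psi x) in *; set (b := psi (1 / x)) in *; set (T := psi t) in *.
set (g := euler_gamma) in *; set (Z := hurwitz2 1 1) in *.
destruct (Rle_or_lt 0 T) as [HT | HT].
(* The identity [T * (a + b) - 2 * a * b = 2 * (a - T) * (T - b) + T * (2 * T - a - b)] settles this
   case. *)
- assert (H1 : 0 < (a - T) * (T - b)) by (apply Rmult_lt_0_compat; lra).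
  assert (H2 : 0 <= T * (2 * T - a - b)) by (apply Rmult_le_pos; lra).
  nra.
- assert (H1 : (- T) * (2 * g) <= (- T) * (- (a + b))) by (apply Rmult_le_compat_l; lra).
  destruct (Rle_or_lt 0 a) as [Ha | Ha].
  + assert (0 <= a * (- b)) by (apply Rmult_le_pos; lra).
    assert (0 < (- T) * g) by (apply Rmult_lt_0_compat; lra).
    lra.
  + specialize (Hprod Ha).
    assert (H2 : g * (g - Z * (t - 1)) <= g * (- T)) by (apply Rmult_le_compat_l; lra).
    assert (H3 : 0 < Z * (t - 1) * (2 * Z - 3 * g)) by (repeat apply Rmult_lt_0_compat; lra).
    nra.
Qed.

Lemma Hmean_comm (a b : R) : Hmean a b = Hmean b a.
Proof. unfold Hmean; rewrite (Rplus_comm a b); f_equal; ring. Qed.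

Lemma digamma_chain (x : R) :
  1 < x ->
  (digamma (Hmean x (1 / x)) <> 0 /\ digamma x + digamma (1 / x) <> 0) /\
  - euler_gamma < - euler_gamma * Hmean x (1 / x) /\
  - euler_gamma * Hmean x (1 / x) < euler_gamma ^ 2 / digamma (Hmean x (1 / x)) /\
  euler_gamma ^ 2 / digamma (Hmean x (1 / x)) < digamma (1 / Hmean x (1 / x)) /\
  digamma (1 / Hmean x (1 / x)) < Hmean (digamma x) (digamma (1 / x)).
Proof.
intros Hx.
set (t := (x + 1 / x) / 2).
assert (Hi : 0 < 1 / x) by (apply Rdiv_lt_0_compat; lra).
assert (Ht : 1 < t) by (assert (H := add_reciprocal_gt_2 x Hx); unfold t; lra).
assert (Hh := reciprocal_lt_1 t Ht).
replace (Hmean x (1 / x)) with (1 / t)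
  by (unfold Hmean, t; field; repeat split; nra).
replace (1 / (1 / t)) with t by (field; lra).
rewrite !digamma_eq_psi by lra.
assert (Hg := euler_gamma_pos).
assert (Hs := psi_add_reciprocal_le x Hx).
assert (Hneg := psi_lt (1 / t) 1 ltac:(lra)); rewrite psi_1 in Hneg.
assert (H1 := mul_psi_lt (1 / t) Hh).
assert (H2 := psi_mul_reciprocal_lt t Ht).
assert (H3 := psi_mean_lt x t Hx ltac:(unfold t; lra)).
repeat split; try lra.
- nra.
(* [psi (1 / t)] is negative, so the denominator is cleared with its opposite. *)
- apply Rmult_lt_reg_r with (- psi (1 / t)); [lra |].
  replace (euler_gamma ^ 2 / psi (1 / t) * - psi (1 / t)) with (- euler_gamma ^ 2)
    by (field; lra).
  nra.
- apply Rmult_lt_reg_r with (- psi (1 / t)); [lra |].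
  replace (euler_gamma ^ 2 / psi (1 / t) * - psi (1 / t)) with (- euler_gamma ^ 2)
    by (field; lra).
  lra.
- unfold Hmean; apply Rmult_lt_reg_r with (- (psi x + psi (1 / x))); [lra |].
  replace (2 * psi x * psi (1 / x) / (psi x + psi (1 / x)) * - (psi x + psi (1 / x)))
    with (- (2 * psi x * psi (1 / x))) by (field; lra).
  lra.
Qed.

Theorem theorem1p1 (x : R) (hx : 0 < x) :
  (digamma (Hmean x (1 / x)) <> 0 /\ digamma x + digamma (1 / x) <> 0) /\
  (x <> 1 ->
     - euler_gamma < - euler_gamma * Hmean x (1 / x) /\
     - euler_gamma * Hmean x (1 / x)
       < euler_gamma ^ 2 / digamma (Hmean x (1 / x)) /\
     euler_gamma ^ 2 / digamma (Hmean x (1 / x))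
       < digamma (1 / Hmean x (1 / x)) /\
     digamma (1 / Hmean x (1 / x)) < Hmean (digamma x) (digamma (1 / x))) /\
  (x = 1 ->
     - euler_gamma = - euler_gamma * Hmean x (1 / x) /\
     - euler_gamma * Hmean x (1 / x)
       = euler_gamma ^ 2 / digamma (Hmean x (1 / x)) /\
     euler_gamma ^ 2 / digamma (Hmean x (1 / x))
       = digamma (1 / Hmean x (1 / x)) /\
     digamma (1 / Hmean x (1 / x)) = Hmean (digamma x) (digamma (1 / x))).
Proof.
destruct (Rtotal_order x 1) as [Hx | [-> | Hx]].
(* Every expression is symmetric in [x] and [1 / x], so this case reduces to [1 / x > 1]. *)
- assert (Hi : 1 < 1 / x).
  { apply Rmult_lt_reg_r with x; [lra |]; replace (1 / x * x) with 1 by (field; lra); lra. }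
  assert (H := digamma_chain (1 / x) Hi).
  replace (1 / (1 / x)) with x in H by (field; lra).
  rewrite (Hmean_comm (1 / x) x), (Hmean_comm (digamma (1 / x))), (Rplus_comm (digamma (1 / x)))
    in H.
  destruct H as [H0 H]; repeat split; try lra; apply H0 || apply H.
(* At [x = 1] every member of the chain is [- euler_gamma], and its being nonzero justifies the
   divisions. *)
- assert (Hg := euler_gamma_pos).
  replace (Hmean 1 (1 / 1)) with 1 by (unfold Hmean; field).
  replace (1 / 1) with 1 by field.
  rewrite digamma_eq_psi, psi_1 by lra; unfold Hmean.
  repeat split; try lra; field; lra.
- destruct (digamma_chain x Hx) as [H0 H]; repeat split; try lra; apply H0 || apply H.
Qed.
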